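(* For each integer $k\geq 1$ let $p=p_k$ be a real number with $0\leq p_k\leq 2^{-(k+1)}$, and let $c=\lim_{k\to\infty}\frac{p_k}{2^{-(k+1)}}$, where $c\in[0,1]$. Let $$b_{\mathrm{U}}=(1+c)\left(1-H\left(\tfrac{1}{c+1}\right)\right).$$ Then $$1-C_{k,p_k}\leq \frac{b_{\mathrm{U}}}{2^{k+1}}(1+o(1)),$$ where $o(1)$ denotes a function of $k$ tending to $0$ as $k\to\infty$.
   Context: $H(x)=-x\log_2 x-(1-x)\log_2(1-x)$ is the binary entropy function (with $0\log_2 0=0$). For finite words $\tau,\omega$ over $\{0,1\}$ with $|\tau|\leq|\omega|$, $T(\tau,\omega)=\frac{1}{|\omega|-|\tau|+1}\,\#\{0\leq i\leq |\omega|-|\tau| : \omega_i\omega_{i+1}\cdots\omega_{i+|\tau|-1}=\tau\}$ is the frequency of $\tau$ as a (contiguous) subword of $\omega$; if $|\tau|>|\omega|$ then $T(\tau,\omega)=0$. Let $1^{k+1}$ denote the word of $k+1$ consecutive ones. The $(0,k,p)$-RLL semiconstrained system is the set of all finite binary words $\omega$ with $T(1^{k+1},\omega)\leq p$. Let $\mathcal{B}_n=\{\omega\in\{0,1\}^n : T(1^{k+1},\omega)\leq p\}$. Its capacity is $C_{k,p}=\limsup_{n\to\infty}\frac1n\log_2|\mathcal{B}_n|$.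
   Formalization: For c = 1 we have b_U = 0 and the bound as written is false (e.g. p_k = 2^{-(k+1)}(1-1/(k+1)) gives C < 1); the bound b_U/2^{k+1}·(1+o(1)) is proved for c < 1, and for all c in [0,1] the additive form 1-C ≤ (b_U+o(1))/2^{k+1}. *)

(* Defs.v *)
From mathcomp Require Import all_boot all_order all_algebra.
From mathcomp Require Import all_classical all_reals all_analysis.

Set Implicit Arguments.
Unset Strict Implicit.
Unset Printing Implicit Defensive.

Import Order.TTheory GRing.Theory Num.Theory.
Import numFieldNormedType.Exports.

Local Open Scope ring_scope.

Definition log2 (R : realType) (x : R) : R := ln x / ln 2.

(* The convention 0 * log2 0 = 0 holds automatically. *)
Definition binary_entropy (R : realType) (x : R) : R :=
  - (x * log2 x) - (1 - x) * log2 (1 - x).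

Definition subword_freq (R : realType) (t w : seq bool) : R :=
  if (size t <= size w)%N then
    #|[set i : 'I_(size w - size t).+1 | take (size t) (drop i w) == t]|%:R
      / (size w - size t).+1%:R
  else 0.

(* The (0, k, p)-RLL semiconstrained system; true is the letter 1. *)
Definition rll (R : realType) (k : nat) (p : R) : pred (seq bool) :=
  fun w => subword_freq R (nseq k.+1 true) w <= p.

Definition rll_words (R : realType) (k : nat) (p : R) (n : nat) :
    {set n.-tuple bool} :=
  [set w : n.-tuple bool | rll k p w].

(* For 0 <= p the sequence takes its values in [0, 1], so that the real-valued
   limn_sup is a genuine limit superior; its irrelevant term at n = 0 is 0. *)
Definition rll_capacity (R : realType) (k : nat) (p : R) : R :=
  limn_sup (fun n : nat => log2 (#|rll_words k p n|%:R : R) / n%:R).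

Definition b_U (R : realType) (c : R) : R :=
  (1 + c) * (1 - binary_entropy (1 / (c + 1))).

(* Main.v *)
(* Insert, after every freshly completed run [1^k] of a word [u] of length [t], a block
   [1^a 0] with [a] of our choice; only the inserted ones create occurrences of
   [1^(k+1)].  A uniformly random [u] completes on average at most
   [t / (2^(k+1) - 2)] such runs, so by Markov's inequality a fixed positive fraction
   of the [u]'s need at most [M] blocks, where [M / t] is just above that mean.  With
   a total of [S ~ p t] inserted ones this produces [2^t * C(M + S, M)] words of
   length [t + M + 1 + S], up to a constant factor.  Stirling's bounds turn the
   binomial coefficient into an entropy, and multiplying the resulting defect by
   [2^(k+1)], so that [M / t] becomes [1 + o(1)] and [p] becomes [c + o(1)], gives
   [b_U c] in the limit by continuity of [x ln x]. *)
Require Import Defs.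
From mathcomp Require Import all_boot all_order all_algebra.
From mathcomp Require Import all_classical all_reals all_analysis.
From mathcomp Require Import zify ring lra.

Import Order.TTheory GRing.Theory Num.Theory.
Import numFieldNormedType.Exports.

Local Open Scope classical_set_scope.
Local Open Scope ring_scope.

(** * Inserting runs of ones *)

Section Encoding.
Local Open Scope nat_scope.

Fixpoint occ (t w : seq bool) : nat :=
  if w is _ :: w' then prefix t w + occ t w' else 0.

Lemma sum_prefix_drop_occ (t w : seq bool) (m : nat) : m <= size w ->
  \sum_(i < m) prefix t (drop i w) <= occ t w.
Proof.
elim: w m => [|x w IH] [|m] //=; rewrite ?big_ord0 // ltnS => mw.
by rewrite big_ord_recl /= leq_add2l IH.
Qed.

Lemma prefix_nseq (a j : nat) (w : seq bool) :
  prefix (nseq a true) (nseq j true ++ false :: w) = (a <= j).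
Proof. by elim: a j => [|a IH] [|j] //=; rewrite IH. Qed.

(** No window of ones crosses the closing zero, and a run of [j] ones has room for [j - k] windows
    of length [k.+1], the truncated subtraction covering short runs. *)
Lemma occ_nseq_false (k j : nat) (w : seq bool) :
  occ (nseq k.+1 true) (nseq j true ++ false :: w) =
  (j - k) + occ (nseq k.+1 true) w.
Proof.
elim: j => [|j IH] //.
rewrite -[LHS]/(prefix (nseq k.+1 true) (nseq j.+1 true ++ false :: w) +
  occ (nseq k.+1 true) (nseq j true ++ false :: w)).
by rewrite IH prefix_nseq; lia.
Qed.

Lemma nseq_cat_cons (j : nat) (w : seq bool) :
  nseq j true ++ true :: w = nseq j.+1 true ++ w.
Proof. by elim: j => [|j IH] //=; rewrite IH. Qed.

Lemma occ_nseq (k j : nat) : j <= k -> occ (nseq k.+1 true) (nseq j true) = 0.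
Proof.
elim: j => [|j IH] // jk; rewrite [LHS]/= IH ?(ltnW jk) // addn0 prefixE.
rewrite size_nseq; case: eqP => // /(congr1 size); rewrite size_take !size_nseq.
by case: ifP; lia.
Qed.

(* [j] is the length of the current run of ones, reset to 0 once it reaches [k]: after
   such a run a block [1^a 0] is inserted. *)
Fixpoint hits (k j : nat) (u : seq bool) : nat :=
  match u with
  | [::] => 0
  | false :: u' => hits k 0 u'
  | true :: u' => if j.+1 == k then (hits k 0 u').+1 else hits k j.+1 u'
  end.

(** Blocks left over once [u] is exhausted are appended in this form, so that the total length
    depends only on the sizes of [u] and [v] and on the sum of [v]. *)
Definition unary (v : seq nat) : seq bool :=
  flatten [seq rcons (nseq a true) false | a <- v].

Fixpoint insert_runs (k j : nat) (u : seq bool) (v : seq nat) : seq bool :=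
  match u with
  | [::] => unary v
  | false :: u' => false :: insert_runs k 0 u' v
  | true :: u' =>
      true :: (if j.+1 == k
               then nseq (head 0 v) true ++
                      false :: insert_runs k 0 u' (behead v)
               else insert_runs k j.+1 u' v)
  end.

Lemma unary_cons (a : nat) (v : seq nat) :
  unary (a :: v) = nseq a true ++ false :: unary v.
Proof. by rewrite /unary /= cat_rcons. Qed.

Lemma nseq_false_inj (a b : nat) (x y : seq bool) :
  nseq a true ++ false :: x = nseq b true ++ false :: y -> a = b /\ x = y.
Proof. by elim: a b => [|a IH] [|b] //= [] // /IH[-> ->]. Qed.

Lemma unary_inj : injective unary.
Proof.
elim=> [|a v IH] [|b w] //; rewrite ?unary_cons.
- by case: b.
- by case: a.
- by move=> /nseq_false_inj[-> /IH ->].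
Qed.

(** Decoding goes from left to right: the letters already read determine the counter [j], hence
    where a block starts, and the block ends at its first zero. The bounds on [hits] ensure that
    [head 0] never falls back on its default. *)
Lemma insert_runs_inj (k j : nat) (u u' : seq bool) (v v' : seq nat) :
  size u = size u' -> hits k j u <= size v -> hits k j u' <= size v' ->
  insert_runs k j u v = insert_runs k j u' v' -> u = u' /\ v = v'.
Proof.
elim: u u' j v v' => [|b u IH] [|b' u'] // j v v' /=.
  by move=> _ _ _ /unary_inj ->.
case=> su; case: b b' => [] [] //; first (case: (j.+1 =P k) => jk).
- case: v v' => [|a v] [|a' v'] //=; rewrite !ltnS => h h'.
  by case=> /nseq_false_inj[-> e]; have [-> ->] := IH _ _ _ _ su h h' e.
- by move=> h h' [e]; have [-> ->] := IH _ _ _ _ su h h' e.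
- by move=> h h' [e]; have [-> ->] := IH _ _ _ _ su h h' e.
Qed.

Lemma size_insert_runs (k j : nat) (u : seq bool) (v : seq nat) :
  hits k j u <= size v ->
  size (insert_runs k j u v) = size u + size v + sumn v.
Proof.
elim: u j v => [|[] u IH] j v /=.
- by elim: v => [|a v IHv] // _; rewrite unary_cons size_cat size_nseq /= IHv //=; lia.
- case: (j.+1 =P k) => jk.
    by case: v => [|a v] //=; rewrite ltnS => h; rewrite size_cat size_nseq /= IH //; lia.
  by move=> h; rewrite IH //; lia.
- by move=> h; rewrite IH //; lia.
Qed.

(** The prefix [nseq j true] carries the current run through the induction. A run of [k] ones
    prolonged by [a] inserted ones contributes [a] occurrences, a shorter run prolonged in this way
    at most [a]. *)
Lemma occ_insert_runs (k j : nat) (u : seq bool) (v : seq nat) : j < k ->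
  occ (nseq k.+1 true) (nseq j true ++ insert_runs k j u v) <= sumn v.
Proof.
elim: u j v => [|b u IH] j v jk.
  case: v => [|a v]; first by rewrite cats0 occ_nseq // ltnW.
  elim: v a j jk => [|b v IHv] a j jk /=; rewrite unary_cons catA -nseqD.
    by rewrite occ_nseq_false /= ; lia.
  rewrite occ_nseq_false; have := IHv b 0 (leq_ltn_trans (leq0n j) jk).
  by rewrite /=; lia.
have k0 : 0 < k by lia.
case: b; rewrite [insert_runs _ _ _ _]/=.
  rewrite nseq_cat_cons; case: eqP => [jk1|jk1].
    rewrite catA -nseqD occ_nseq_false.
    by have := IH 0 (behead v) k0; rewrite cat0s; case: v => [|a v] /=; lia.
  by apply: IH; lia.
by rewrite occ_nseq_false; have := IH 0 v k0; rewrite cat0s; lia.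
Qed.

(** * Counting the words and the lists of blocks *)

Fixpoint words (t : nat) : seq (seq bool) :=
  if t is t'.+1 then
    [seq false :: u | u <- words t'] ++ [seq true :: u | u <- words t']
  else [:: [::]].

Lemma size_words (t : nat) : size (words t) = 2 ^ t.
Proof. by elim: t => [|t IH] //=; rewrite size_cat !size_map IH expnS; lia. Qed.

Lemma size_mem_words (t : nat) (u : seq bool) : u \in words t -> size u = t.
Proof.
elim: t u => [|t IH] u /=; first by rewrite inE => /eqP ->.
by rewrite mem_cat => /orP[] /mapP[x /IH <- ->].
Qed.

Lemma uniq_words (t : nat) : uniq (words t).
Proof.
elim: t => [|t IH] //=; rewrite cat_uniq !map_inj_uniq ?IH /= ?andbT; last 2 first.
- by move=> x y [].
- by move=> x y [].
by apply/hasPn => _ /mapP[x _ ->]; apply/mapP => -[].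
Qed.

(* [r t + h_j] with [r = 1 / (2 (2 ^ k - 1))] and [h_j = 2 r (2 ^ j - 1)] is an exact
   solution of the recursion satisfied by the mean of [hits k j] over words of
   length [t]; it dominates because [h_j >= 0]. *)
Lemma sum_hits (k j t : nat) : j < k ->
  (2 ^ k - 1).*2 * (\sum_(u <- words t) hits k j u) <=
    2 ^ t * (t + (2 ^ j - 1).*2).
Proof.
elim: t j => [|t IH] j jk; first by rewrite /= big_seq1 muln0.
rewrite /= big_cat !big_map /=.
have I0 := IH 0 (leq_ltn_trans (leq0n j) jk).
have ej : 2 ^ j.+1 = 2 * 2 ^ j by rewrite expnS.
have pj : 0 < 2 ^ j by rewrite expn_gt0.
case: eqP => [jk1|jk1].
  under [X in _ * (_ + X)]eq_bigr do rewrite -add1n.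
  rewrite big_split /= big_const_seq count_predT iter_addn_0 size_words mul1n.
  rewrite -jk1 ej expnS in I0 *; rewrite expn0 subnn addn0 in I0.
  move: (\sum_(_ <- _) _) (2 ^ t) (2 ^ j) pj I0 => s a [|b] // _.
  rewrite -!mul2n mulnS !addSn !subSS !subn0; nia.
have := IH j.+1 (ltac:(lia)); rewrite ej expnS; rewrite expn0 subnn addn0 in I0.
move: (\sum_(_ <- _) hits k 0 _) (\sum_(_ <- _) hits k j.+1 _) I0 => s s'.
move: (2 ^ t) (2 ^ j) (2 ^ k - 1).*2 pj => a [|b] c // _.
rewrite -!mul2n mulnS !addSn !subSS !subn0; nia.
Qed.

(* Markov's inequality: words of this length have on average at most [2 ^ k * s] hits. *)
Lemma few_hits (k s : nat) : 0 < k ->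
  2 ^ ((2 ^ k - 1).*2 * (2 ^ k * s)) <=
  (2 ^ k + 1) * size [seq u <- words ((2 ^ k - 1).*2 * (2 ^ k * s)) |
                       hits k 0 u <= (2 ^ k + 1) * s].
Proof.
move=> k0; case: s => [|s]; first by rewrite !muln0 /=; lia.
set m := (2 ^ k + 1) * s.+1; move tE : (_.*2 * _) => t; rewrite size_filter; move/esym: tE => tE.
have := sum_hits k 0 t k0; rewrite expn0 subnn addn0 [X in _ <= _ * X]tE mulnCA leq_pmul2l; last first.
  have : 1 < 2 ^ k by rewrite -{1}(expn0 2) ltn_exp2l.
  lia.
move=> H.
have M : m * count (predC (fun u => hits k 0 u <= m)) (words t) <=
    \sum_(u <- words t) hits k 0 u.
  rewrite -sum1_count big_distrr /= [leqRHS](bigID (predC (fun u => hits k 0 u <= m))) /=.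
  apply: leq_trans (leq_addr _ _); apply: leq_sum => u; rewrite muln1 -ltnNge.
  exact: ltnW.
have C := count_predC (fun u => hits k 0 u <= m) (words t).
rewrite size_words in C; move: (leq_trans M H); rewrite -C [X in X <= _]mulnAC mulnA leq_pmul2r //.
move: (count _ _) (count (predC _) _) (2 ^ k) => a b c; nia.
Qed.

(** Stars and bars. One part beyond the [M] that may be consumed makes the count exactly
    ['C(M + S, M)]. *)
Lemma size_compositions (M S : nat) : exists V : seq (seq nat),
  [/\ uniq V, size V = 'C(M + S, M) &
      forall v, v \in V -> size v = M.+1 /\ sumn v = S].
Proof.
(* No part exceeds the sum, so the parts can be drawn from ['I_S.+1]. *)
pose P := [set t : M.+1.-tuple 'I_S.+1 | \sum_(i <- t) i == S]%SET.
exists [seq map val (val t) | t <- enum P]; split.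
- rewrite map_inj_uniq ?enum_uniq // => x y; move/inj_map => e.
  by apply/val_inj/e/val_inj.
- by rewrite size_map -cardE /P card_ord_partitions.
- move=> v /mapP[x]; rewrite mem_enum inE => /eqP sx ->.
  by rewrite size_map size_tuple sumnE big_map.
Qed.

Lemma subword_freq_le (R : realType) (k : nat) (w : seq bool) (S : nat) :
  occ (nseq k.+1 true) w <= S -> k < size w ->
  (subword_freq R (nseq k.+1 true) w <= S%:R / (size w - k)%:R)%R.
Proof.
move=> oS kw; rewrite /subword_freq size_nseq kw subnSK // ler_wpM2r //.
rewrite ler_nat; apply: leq_trans oS; rewrite -sum1dep_card big_mkcond /=.
apply: leq_trans (sum_prefix_drop_occ _ w (size w - k) _); last first.
  exact: leq_subr.
by apply: leq_sum => i _; rewrite prefixE /= size_nseq; case: ifP.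
Qed.

(** Distinct pairs of a word with at most [M] hits and a list of [M.+1] blocks of sum [S] yield
    distinct admissible words; the factor [2 ^ k + 1] is the loss in Markov's inequality. *)
Lemma rll_words_ge (R : realType) (k s S : nat) (p : R) :
  let t := (2 ^ k - 1).*2 * (2 ^ k * s) in
  let M := (2 ^ k + 1) * s in
  let n := t + M.+1 + S in
  0 < k -> k < n -> (S%:R <= p * (n - k)%:R)%R ->
  2 ^ t * 'C(M + S, M) <= (2 ^ k + 1) * #|rll_words k p n|.
Proof.
move=> t M n k0 kn Sp.
have [V [uV sV VP]] := size_compositions M S.
set U := [seq u <- words t | hits k 0 u <= M].
apply: leq_trans (leq_mul (few_hits k s k0) (leqnn _)) _.
rewrite -mulnA leq_mul2l -/t -/M -/U -sV; apply/orP; right.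
rewrite -(size_allpairs (insert_runs k 0) U V) cardE -(size_map val).
apply: uniq_leq_size.
  apply: allpairs_uniq => //; first by rewrite filter_uniq ?uniq_words.
  move=> [u v] [u' v'] /allpairsP[[? ?] /= [+ + [-> ->]]].
  rewrite mem_filter => /andP[h /size_mem_words su] /VP[sv _].
  move=> /allpairsP[[? ?] /= [+ + [-> ->]]].
  rewrite mem_filter => /andP[h' /size_mem_words su'] /VP[sv' _] e.
  have [|||-> ->//] := insert_runs_inj _ _ _ _ _ _ _ _ _ e.
  - by rewrite su su'.
  - by rewrite sv leqW.
  - by rewrite sv' leqW.
move=> _ /allpairsP[[u v] /= [+ + ->]].
rewrite mem_filter => /andP[h /size_mem_words su] /VP[sv Sv].
have sz : size (insert_runs k 0 u v) = n.
  by rewrite size_insert_runs ?su ?sv ?Sv // leqW.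
apply/mapP; exists (tcast sz (in_tuple (insert_runs k 0 u v))); last first.
  by rewrite val_tcast.
rewrite mem_enum inE /rll val_tcast /=.
apply: le_trans (subword_freq_le R k _ S _ _) _.
- by rewrite -Sv; have := occ_insert_runs k 0 u v k0.
- by rewrite sz.
- by rewrite sz ler_pdivrMr // ltr0n subn_gt0.
Qed.

End Encoding.

(** * Entropy bounds for binomial coefficients *)

(** As [ln] is 0 on nonpositive numbers, the entropy convention at 0 is built in. *)
Definition xlnx {R : realType} (x : R) : R := x * ln x.

(** With [r] the square root of [x], [- ln r = ln r^-1 <= r^-1] bounds [r * - ln r] by 1. This gives
    continuity of [xlnx] at 0. *)
Lemma normr_xlnx_le (R : realType) (x : R) : x <= 1 ->
  `|xlnx x| <= 2 * Num.sqrt x.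
Proof.
move=> x1; rewrite /xlnx; have [x0|x0] := leP x 0.
  by rewrite ln0 // mulr0 normr0 mulr_ge0 // sqrtr_ge0.
set r := Num.sqrt x; have r0 : 0 < r by rewrite sqrtr_gt0.
have xE : x = r * r by rewrite -expr2 sqr_sqrtr // ltW.
have lnr : - ln r <= r^-1.
  rewrite -lnV ?posrE //; apply/ltW/ln_sublinear; by rewrite invr_gt0.
have := ln_le0 x1; rewrite xE lnM ?posrE // => l0.
rewrite ler0_norm; last by rewrite mulr_ge0_le0 // mulr_ge0 // ltW.
have -> : - (r * r * (ln r + ln r)) = 2 * r * (r * - ln r) by ring.
rewrite ler_piMr //; first by rewrite mulr_ge0 // ltW.
by rewrite -(mulfV (lt0r_neq0 r0)) ler_wpM2l // ltW.
Qed.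

Lemma continuous_xlnx (R : realType) (x : R) : 0 <= x ->
  {for x, continuous (@xlnx R)}.
Proof.
rewrite le_eqVlt => /orP[/eqP <-|x0]; last first.
  by apply: continuousM; [exact: cvg_id|exact: continuous_ln].
rewrite /prop_for /continuous_at /xlnx mul0r; apply/norm_cvg0P.
have s0 : (fun y : R => 2 * Num.sqrt y) @ (0 : R) --> (0 : R).
  by rewrite -[X in _ --> X](mulr0 2) -[in X in _ --> X](@sqrtr0 R);
    apply: cvgM; [exact: cvg_cst|exact: sqrt_continuous].
apply: (squeeze_cvgr _ (cvg_cst 0) s0); near=> y.
rewrite normr_ge0 normr_xlnx_le // ltW //; near: y.
exact: (lt_nbhsl ltr01).
Unshelve. all: by end_near. Qed.

(** The [ln t] term is linear in [x], so it cancels in [xlnx (a + b) - xlnx a - xlnx b], which is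
    therefore homogeneous of degree one. *)
Lemma xlnxM (R : realType) (t x : R) : 0 < t -> 0 <= x ->
  xlnx (t * x) = t * xlnx x + t * x * ln t.
Proof.
move=> t0; rewrite le_eqVlt => /orP[/eqP <-|x0].
  by rewrite /xlnx !(mulr0, mul0r) addr0.
by rewrite /xlnx lnM ?posrE //; ring.
Qed.

(* At [n = 0] the upper bound still holds since [ln 0 = 0]. *)
Lemma ln_fact_bounds (R : realType) (n : nat) :
  xlnx (n%:R : R) - n%:R <= ln (n`!%:R : R) <= xlnx n%:R - n%:R + 1 + ln n%:R.
Proof.
elim: n => [|n IH]; first by rewrite /xlnx mul0r subr0 ln1 ln0 // lexx add0r addr0 ler01.
have n1 : 0 < n.+1%:R :> R by rewrite ltr0n.
rewrite factS natrM lnM ?posrE ?ltr0n ?fact_gt0 //.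
case: n => [|n] in IH n1 *.
  by rewrite /xlnx !ln1 mulr0 addr0; lra.
set x : R := n.+1%:R in IH *; have x0 : 0 < x by rewrite ltr0n.
have -> : n.+2%:R = x + 1 :> R by rewrite -natr1.
have x1 : 0 < x + 1 by rewrite addr_gt0.
have up : ln (x + 1) - ln x <= x^-1.
  rewrite -ln_div ?posrE // mulrDl mulfV ?lt0r_neq0 // mul1r; apply: le_ln1Dx.
  by rewrite (lt_trans _ (_ : 0 < _)) ?invr_gt0 // ltrN10.
have lo : ln x - ln (x + 1) <= - (x + 1)^-1.
  have -> : ln x - ln (x + 1) = ln (1 - (x + 1)^-1).
    rewrite -ln_div ?posrE //; congr ln; field; exact: lt0r_neq0.
  apply: le_ln1Dx; rewrite ltrN2 invf_lt1 // ltrDr //.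
have {up}up : x * (ln (x + 1) - ln x) <= 1.
  by rewrite mulrC -ler_pdivlMr // div1r.
have {lo}lo : (x + 1) * (ln x - ln (x + 1)) <= - 1.
  by rewrite mulrC -ler_pdivlMr // mulN1r.
by move: IH; rewrite /xlnx; move: (ln x) (ln (x + 1)) (ln _) up lo => a b d; lra.
Qed.

(** The lower bound is applied to the factorial of [a + b] and the upper one to those of [a] and
    [b]; the linear terms cancel, and each upper bound leaves a 1 and a logarithm. *)
Lemma ln_bin_ge (R : realType) (a b : nat) :
  xlnx (a%:R + b%:R : R) - xlnx a%:R - xlnx b%:R - 2 - ln a%:R - ln b%:R <=
  ln ('C(a + b, a)%:R : R).
Proof.
have := bin_fact (leq_addr b a); rewrite addKn => /(congr1 (fun n => ln (n%:R : R))).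
have f0 n : 0 < n`!%:R :> R by rewrite ltr0n fact_gt0.
rewrite !natrM !lnM ?posrE ?mulr_gt0 // ?ltr0n ?bin_gt0 ?leq_addr // => e.
have := ln_fact_bounds R (a + b); have := ln_fact_bounds R a.
have := ln_fact_bounds R b; rewrite -e natrD; lra.
Qed.

(** As [s <= f s], the value [u (f s)] belongs to the tail starting at [s] and is at most
    [sups u s]. *)
Lemma le_limn_sup_subseq (R : realType) (u : R^nat) (f : nat -> nat) (v : R^nat)
    (l : R) :
  has_ubound (range u) -> has_lbound (range u) -> (forall s, (s <= f s)%N) -> (\forall s \near \oo, v s <= u (f s)) ->
  v @ \oo --> l -> l <= limn_sup u.
Proof.
move=> uu ul fs vu vl.
have cu : cvgn (sups u) by apply/cvg_ex; eexists; exact: cvg_sups_inf.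
rewrite -(cvg_lim _ vl) //; apply: ler_lim => //; first by apply/cvg_ex; exists l.
near=> s; apply: (@le_trans _ _ (u (f s))); first by near: s.
apply: ub_le_sup; first exact: has_ubound_sdrop.
by exists (f s) => //; exact: fs.
Unshelve. all: by end_near. Qed.

(** * Capacity *)

Lemma cvg_truncn_div (R : realType) (x : R) (T : nat -> nat) : 0 <= x ->
  (forall s, (0 < T s)%N) -> (fun s => (T s)%:R^-1 : R) @ \oo --> (0 : R) ->
  (fun s => (Num.truncn (x * (T s)%:R))%:R / (T s)%:R) @ \oo --> x.
Proof.
move=> x0 T0 Tl.
have lo : (fun s => x - (T s)%:R^-1) @ \oo --> x.
  by rewrite -[X in _ --> X](subr0 x); apply: cvgB => //; exact: cvg_cst.
apply: (squeeze_cvgr _ lo (cvg_cst x)); apply: nearW => s.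
have Ts : 0 < (T s)%:R :> R by rewrite ltr0n.
have /andP[h1 h2] := truncn_itv (mulr_ge0 x0 (ltW Ts)).
rewrite ler_pdivrMr // h1 andbT ler_pdivlMr // mulrBl mulVf ?lt0r_neq0 //.
by rewrite lerBlDr natr1 ltW.
Qed.

(* The limit of [1 - log2 (2^t * C(M + S, M)) / (t + M + S)] when [M / t] tends to [mu]
   and [S / t] tends to [p]. *)
Definition rate_defect {R : realType} (mu p : R) : R :=
  ((mu + p) * ln 2 - (xlnx (mu + p) - xlnx mu - xlnx p)) / (1 + mu + p) / ln 2.

(** This is [M / t]: the bound [1 / (2 (2 ^ k - 1))] on the mean density of completed runs, raised
    by the factor [1 + 2 ^- k] to leave room for Markov's inequality. *)
Definition slot_ratio (R : realType) (k : nat) : R :=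
  (2 ^ k + 1)%:R / ((2 ^ k - 1).*2 * 2 ^ k)%:R.

Lemma ln2_gt0 (R : realType) : 0 < ln 2 :> R.
Proof. by apply: ln_gt0; rewrite ltr1n. Qed.

Lemma ler_ln_nat (R : realType) (m n : nat) : (m <= n)%N ->
  ln (m%:R : R) <= ln n%:R.
Proof.
case: m => [|m] mn; last by rewrite ler_ln ?posrE ?ltr0n ?ler_nat ?(leq_trans _ mn).
by rewrite ln0 //; case: n {mn} => [|n]; [rewrite ln0|rewrite ln_ge0 // ler1n].
Qed.

Lemma log2_card_bounds (R : realType) (k n : nat) (p : R) : 0 <= p ->
  0 <= log2 (#|rll_words k p n|%:R : R) / n%:R <= 1.
Proof.
move=> p0; have l2 := ln2_gt0 R.
have -> : 0 <= log2 (#|rll_words k p n|%:R : R) / n%:R.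
  rewrite mulr_ge0 ?invr_ge0 // mulr_ge0 ?invr_ge0 ?(ltW l2) //.
  by rewrite -(ln0 (lexx (0 : R))) (ler_ln_nat R 0).
case: n => [|n]; first by rewrite invr0 mulr0 ler01.
rewrite /= ler_pdivrMr ?ltr0n // mul1r ler_pdivrMr // mulr_natl -lnXn ?ltr0n //.
rewrite -natrX ler_ln_nat //; apply: leq_trans (max_card _) _.
by rewrite card_tuple card_bool.
Qed.

Section Capacity.
Variables (R : realType) (k : nat).
Hypothesis k0 : (0 < k)%N.

(** The shift to [s.+1] makes [t s] positive for every [s], so that one may divide by it. *)
Let t (s : nat) : nat := ((2 ^ k - 1).*2 * (2 ^ k * s.+1))%N.
Let M (s : nat) : nat := ((2 ^ k + 1) * s.+1)%N.
Let mu : R := slot_ratio R k.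

Lemma slots_le (s : nat) : (M s <= t s)%N.
Proof.
have : (2 <= 2 ^ k)%N by rewrite -{1}(expn1 2) leq_exp2l.
rewrite /M /t mulnA leq_mul2r /=; case: (2 ^ k)%N => [|b] //; nia.
Qed.

Lemma t_gt (s : nat) : (s < t s)%N.
Proof.
apply: leq_trans (slots_le s); rewrite /M; apply: leq_pmull; by rewrite addn1.
Qed.

Lemma slotsE (s : nat) : (M s)%:R = (t s)%:R * mu.
Proof.
have t0 : (t s)%:R != 0 :> R by rewrite pnatr_eq0 -lt0n (leq_ltn_trans _ (t_gt s)).
have tE : (t s)%:R = ((2 ^ k - 1).*2 * 2 ^ k)%:R * s.+1%:R :> R.
  by rewrite -natrM /t mulnA.
rewrite tE mulf_eq0 negb_or in t0; case/andP: t0 => t1 t2.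
rewrite tE /mu /slot_ratio /M natrM.
by move: ((2 ^ k - 1).*2 * 2 ^ k)%:R t1 => c c0; field.
Qed.

Lemma mu_gt0 : 0 < mu.
Proof.
have := slotsE 0; have t0 : 0 < (t 0)%:R :> R by rewrite ltr0n (leq_ltn_trans _ (t_gt 0)).
by move/(congr1 (fun x => x / (t 0)%:R)); rewrite mulrAC mulfV ?lt0r_neq0 // mul1r => <-;
  rewrite divr_gt0 // ltr0n /M muln1 addn1.
Qed.

(** Logarithms of the counting bound are divided by [T]. Markov and Stirling cost
    [2 + ln (2 ^ k + 1)] and [ln M + ln S <= 2 ln T]; writing [- ln T / T] as [xlnx T^-1] lets
    continuity at 0 dispose of it. *)
Lemma rate_ge (p : R) (s S : nat) :
  let T : R := (t s)%:R in let x := S%:R / T in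
  let n := (t s + (M s).+1 + S)%N in
  (k < n)%N -> (S <= t s)%N -> S%:R <= p * (n - k)%:R ->
  (ln 2 + (xlnx (mu + x) - xlnx mu - xlnx x) - (2 + ln (2 ^ k + 1)%:R) / T
    + 2 * xlnx T^-1) / (1 + mu + x + T^-1) / ln 2
  <= log2 (#|rll_words k p n|%:R : R) / n%:R.
Proof.
move=> T x n kn St Sp.
have T0 : 0 < T by rewrite ltr0n (leq_ltn_trans _ (t_gt s)).
have x0 : 0 <= x by rewrite divr_ge0 // ltW.
have SE : S%:R = T * x by rewrite mulrC divfK ?lt0r_neq0.
have nE : n%:R = T * (1 + mu + x + T^-1).
  rewrite /n -addn1 !natrD slotsE SE -/T !mulrDr mulfV ?lt0r_neq0 //; ring.
have D0 : 0 < 1 + mu + x + T^-1.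
  by rewrite addr_gt0 ?invr_gt0 // ltr_wpDr // addr_gt0 // mu_gt0.
rewrite /log2 [leRHS]mulrAC ler_pM2r ?invr_gt0 ?ln2_gt0 //.
rewrite nE invfM [leRHS]mulrA ler_pM2r ?invr_gt0 // ler_pdivlMr //.
have W : (2 ^ t s * 'C(M s + S, M s) <= (2 ^ k + 1) * #|rll_words k p n|)%N :=
  rll_words_ge R k s.+1 S p k0 kn Sp.
have := ler_ln_nat R _ _ W.
have c0 : (0 < 'C(M s + S, M s))%N by rewrite bin_gt0 leq_addr.
have w0 : (0 < #|rll_words k p n|)%N.
  have : (0 < 2 ^ t s * 'C(M s + S, M s))%N by rewrite muln_gt0 expn_gt0 c0.
  by move/leq_trans/(_ W); rewrite muln_gt0 => /andP[].
have b0 : (0 < 2 ^ k + 1)%N by rewrite addn1.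
rewrite !natrM natrX !lnM ?posrE ?exprn_gt0 ?ltr0n // lnXn ?ltr0n //.
have := ln_bin_ge R (M s) S.
rewrite {1 2}slotsE {1 2}SE -mulrDr !(xlnxM _ _ _ T0) ?addr_ge0 ?(ltW mu_gt0) //.
have := ler_ln_nat R _ _ (slots_le s); have := ler_ln_nat R _ _ St.
rewrite -/T -[ln 2 *+ _]mulr_natl -/T.
have -> : xlnx T^-1 = - (ln T / T) by rewrite /xlnx lnV ?posrE //; ring.
move=> h1 h2 h3 h4.
have -> : (ln 2 + (xlnx (mu + x) - xlnx mu - xlnx x) - (2 + ln (2 ^ k + 1)%:R) / T +
    2 * - (ln T / T)) * T = T * ln 2 + T * (xlnx (mu + x) - xlnx mu - xlnx x)
    - 2 - ln (2 ^ k + 1)%:R - 2 * ln T.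
  by field; exact: lt0r_neq0.
move: (ln (2 ^ k + 1)%:R) h4 => lb; lra.
Qed.

(** The integer part of [p * T s] is taken as the number of inserted ones, and [rate_ge] is applied
    along the resulting lengths as [s] grows with [k] fixed. *)
Lemma capacity_defect_le (p : R) : 0 <= p <= 1 ->
  1 - rll_capacity k p <= rate_defect mu p.
Proof.
case/andP => p0 p1; pose T (s : nat) : R := (t s)%:R.
have T0 s : 0 < T s by rewrite ltr0n (leq_ltn_trans _ (t_gt s)).
pose S s := Num.truncn (p * T s).
have Tl : (fun s => (T s)^-1) @ \oo --> (0 : R).
  apply: (squeeze_cvgr _ (cvg_cst 0) (@cvg_harmonic R)); apply: nearW => s.
  rewrite invr_ge0 (ltW (T0 s)) /harmonic /= lef_pV2 ?posrE ?T0 ?ltr0n //.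
  by rewrite ler_nat t_gt.
pose x s := (S s)%:R / T s.
have xl : x @ \oo --> p.
  apply: cvg_truncn_div => // s; exact: leq_ltn_trans (t_gt s).
have m0 := mu_gt0; have D0 : 1 + mu + p != 0.
  by rewrite lt0r_neq0 // ltr_wpDr // addr_gt0.
have l2 := lt0r_neq0 (ln2_gt0 R).
pose v s := (ln 2 + (xlnx (mu + x s) - xlnx mu - xlnx (x s))
  - (2 + ln (2 ^ k + 1)%:R) / T s + 2 * xlnx (T s)^-1) / (1 + mu + x s + (T s)^-1) / ln 2.
have vl : v @ \oo --> 1 - rate_defect mu p.
  have -> : 1 - rate_defect mu p = (ln 2 + (xlnx (mu + p) - xlnx mu - xlnx p)
      - (2 + ln (2 ^ k + 1)%:R) * 0 + 2 * xlnx 0) / (1 + mu + p + 0) / ln 2.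
    rewrite /rate_defect [xlnx 0]mul0r !mulr0 subr0 !addr0; field.
    by rewrite l2 D0.
  apply: cvgM; last exact: cvg_cst.
  apply: cvgM; last first.
    apply: cvgV; first by rewrite addr0.
    by apply: cvgD => //; apply: cvgD => //; exact: cvg_cst.
  apply: cvgD; last first.
    apply: cvgM; first exact: cvg_cst.
    by apply: continuous_cvg Tl; exact: continuous_xlnx.
  apply: cvgB; last by apply: cvgM => //; exact: cvg_cst.
  apply: cvgD; first exact: cvg_cst.
  apply: cvgB; last by apply: continuous_cvg xl; exact: continuous_xlnx.
  apply: cvgB; last exact: cvg_cst.
  apply: continuous_cvg; first by apply: continuous_xlnx; rewrite addr_ge0 // ltW.
  by apply: cvgD => //; exact: cvg_cst.
rewrite lerBlDr addrC -lerBlDr.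
pose f s := (t s + (M s).+1 + S s)%N.
apply: (@le_limn_sup_subseq _ _ f v _ _ _ _ _ vl).
- by exists 1 => _ [n _ <-]; case/andP: (log2_card_bounds R k n p p0).
- by exists 0 => _ [n _ <-]; case/andP: (log2_card_bounds R k n p p0).
- by move=> s; rewrite /f; have := t_gt s; lia.
(* From [s = k] on, [M s > k] absorbs the loss of [k] window positions: [n - k >= t s]. *)
exists k => // s /= ks.
have sM : (s < M s)%N by rewrite /M; apply: leq_pmull; rewrite addn1.
have S1 : (S s)%:R <= p * T s by rewrite truncn_le mulr_ge0 // ltW.
apply: rate_ge.
- by lia.
- rewrite -(ler_nat R); apply: le_trans S1 _; by rewrite ler_piMl // ltW.
- by apply: le_trans S1 _; rewrite ler_wpM2l // ler_nat; lia.
Qed.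

End Capacity.

(** * The scaled defect as [k] tends to infinity *)

(** The vanishing term [xlnx 1] is kept so that the numerator has the shape of that of [rate_defect]
    with [mu = 1] and [p = c]. *)
Lemma b_UE (R : realType) (c : R) : 0 <= c ->
  b_U c = ((1 + c) * ln 2 - (xlnx (1 + c) - xlnx 1 - xlnx c)) / ln 2.
Proof.
move=> c0; have l2 := lt0r_neq0 (ln2_gt0 R).
rewrite /b_U /binary_entropy /log2 /xlnx ln1 mulr0 subr0 (addrC c).
have d0 : 0 < 1 + c by rewrite ltr_wpDr.
have dn := lt0r_neq0 d0; rewrite div1r lnV ?posrE //.
have -> : 1 - (1 + c)^-1 = c / (1 + c) by field.
move: c0; rewrite le_eqVlt => /orP[/eqP <-|c0].
  by rewrite !mul0r !addr0 ln1; field.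
by rewrite ln_div ?posrE //; field; rewrite l2 dn.
Qed.

(** [b_U c * ln 2] equals [- ln ((1 + c) / 2) - c * ln ((1 + c) / (2 * c))]. By [ln x <= x - 1],
    strict in the first term since [c < 1], the two bounds [(1 - c) / 2] cancel and leave a positive
    value. *)
Lemma b_U_gt0 (R : realType) (c : R) : 0 <= c < 1 -> 0 < b_U c.
Proof.
case/andP=> c0 c1; rewrite b_UE // divr_gt0 ?ln2_gt0 // /xlnx ln1 mulr0 subr0.
have d0 : 0 < 1 + c by rewrite ltr_wpDr.
have h0 : 0 < (1 + c) / 2 by rewrite divr_gt0.
have hE : ln (1 + c) = ln ((1 + c) / 2) + ln 2.
  by rewrite -lnM ?posrE // divfK.
have h1 : ln ((1 + c) / 2) < (1 + c) / 2 - 1.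
  rewrite ltrBrDl -[ltRHS](lnK (x := (1 + c) / 2)) ?posrE //; apply: expR_gt1Dx.
  by rewrite ln_eq0 // lt_eqF //; lra.
move: c0; rewrite le_eqVlt => /orP[/eqP c0|c0].
  by rewrite -c0 mul0r !addr0 ln1 mulr0 !subr0 mul1r ln2_gt0.
have h2 : c * (ln (1 + c) - ln 2 - ln c) <= (1 - c) / 2.
  have -> : ln (1 + c) - ln 2 - ln c = ln (1 + ((1 + c) / (2 * c) - 1)).
    have -> : 1 + ((1 + c) / (2 * c) - 1) = (1 + c) / (2 * c) by ring.
    rewrite ln_div ?posrE ?mulr_gt0 // lnM ?posrE //; ring.
  have -> : (1 - c) / 2 = c * ((1 + c) / (2 * c) - 1).
    by field; rewrite lt0r_neq0.
  rewrite ler_wpM2l ?(ltW c0) //; apply: le_ln1Dx.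
  by rewrite ltrBrDr addNr divr_gt0 // mulr_gt0.
by move: h1 h2; rewrite hE; move: (ln _) (ln 2) (ln c) => a b d; lra.
Qed.

Lemma scale_rate_defect (R : realType) (y mu p : R) : 0 < y -> 0 <= mu -> 0 <= p ->
  y * rate_defect mu p =
  ((y * mu + y * p) * ln 2 - (xlnx (y * mu + y * p) - xlnx (y * mu) - xlnx (y * p)))
    / (1 + mu + p) / ln 2.
Proof.
move=> y0 m0 p0; rewrite -mulrDr !xlnxM ?addr_ge0 // /rate_defect !mulrA.
by do 2 congr (_ / _); rewrite /xlnx; ring.
Qed.

Lemma slot_ratioE (R : realType) (k : nat) : (1 <= k)%N ->
  2 ^+ k.+1 * slot_ratio R k = (1 + 2 ^- k) / (1 - 2 ^- k).
Proof.
move=> k1; rewrite /slot_ratio -mul2n !natrM natrD natrB ?expn_gt0 // natrX exprS.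
have : 1 < 2 ^+ k :> R by rewrite exprn_egt1 ?ltr1n // -lt0n.
move: (2 ^+ k) => x x1; field; lra.
Qed.

Lemma cvg_scaled_defect (R : realType) (p : nat -> R) (c : R) :
  (forall k : nat, (1 <= k)%N -> 0 <= p k) ->
  (fun k : nat => p k / 2 ^- k.+1) @ \oo --> c -> 0 <= c ->
  (fun k => 2 ^+ k.+1 * rate_defect (slot_ratio R k) (p k)) @ \oo --> b_U c.
Proof.
move=> hp hc c0; have l2 := lt0r_neq0 (ln2_gt0 R).
have pw : (fun k : nat => 2 ^- k : R) @ \oo --> (0 : R).
  have -> : (fun k : nat => 2 ^- k : R) = (fun k => 2^-1 ^+ k).
    by apply/funext => k; rewrite exprVn.
  by apply: cvg_expr; rewrite ger0_norm ?invr_ge0 // invf_lt1 // ltr1n.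
have pw1 : (fun k : nat => 2 ^- k.+1 : R) @ \oo --> (0 : R).
  by rewrite -(cvg_shiftS (fun k : nat => 2 ^- k : R)) in pw.
pose rho (k : nat) : R := (1 + 2 ^- k) / (1 - 2 ^- k).
have rhol : rho @ \oo --> (1 : R).
  have -> : (1 : R) = (1 + 0) / (1 - 0) by rewrite addr0 subr0 divr1.
  apply: cvgM; first by apply: cvgD => //; exact: cvg_cst.
  apply: cvgV; first by rewrite subr0 oner_neq0.
  by apply: cvgB => //; exact: cvg_cst.
pose q (k : nat) : R := p k / 2 ^- k.+1.
(* The scaled defect expressed through [rho] and [q], with [mu] and [p] recovered in the denominator
   by the factor [2 ^- k.+1]; the two agree for [k >= 1]. *)
pose g (k : nat) : R :=
  ((rho k + q k) * ln 2 - (xlnx (rho k + q k) - xlnx (rho k) - xlnx (q k)))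
    / (1 + rho k * 2 ^- k.+1 + q k * 2 ^- k.+1) / ln 2.
have gl : g @ \oo --> b_U c.
  have -> : b_U c = ((1 + c) * ln 2 - (xlnx (1 + c) - xlnx 1 - xlnx c))
      / (1 + 1 * 0 + c * 0) / ln 2.
    by rewrite b_UE // !mulr0 !addr0 divr1.
  have rq : (fun k => rho k + q k) @ \oo --> 1 + c by exact: cvgD.
  apply: cvgM; last exact: cvg_cst.
  apply: cvgM; last first.
    apply: cvgV; first by rewrite !mulr0 !addr0 oner_neq0.
    apply: cvgD; last exact: cvgM.
    apply: cvgD; first exact: cvg_cst.
    exact: cvgM.
  apply: cvgB; first by apply: cvgM => //; exact: cvg_cst.
  apply: cvgB; last by apply: continuous_cvg hc; exact: continuous_xlnx.
  apply: cvgB; last by apply: continuous_cvg rhol; exact: continuous_xlnx.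
  by apply: continuous_cvg rq; apply: continuous_xlnx; rewrite addr_ge0.
apply: cvg_trans gl; apply: near_eq_cvg; near=> k.
have k1 : (1 <= k)%N by near: k; exists 1%N.
have y0 : 0 < 2 ^+ k.+1 :> R by rewrite exprn_gt0.
have yn := lt0r_neq0 y0.
rewrite scale_rate_defect ?hp ?(ltW (mu_gt0 R k k1)) // slot_ratioE //.
rewrite /g /q /rho -slot_ratioE // invrK.
by rewrite ![2 ^+ k.+1 * _]mulrC !mulfK.
Unshelve. all: by end_near. Qed.

Theorem theorem30 (R : realType) (p : nat -> R) (c : R)
  (hp : forall k : nat, (1 <= k)%N -> 0 <= p k <= 2 ^- k.+1)
  (hc : (fun k : nat => p k / 2 ^- k.+1) @ \oo --> c) :
  (c < 1 ->
    exists e : nat -> R, e @ \oo --> (0 : R) /\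
      forall k : nat, (1 <= k)%N ->
        1 - rll_capacity k (p k) <= b_U c / 2 ^+ k.+1 * (1 + e k))
  /\
  (exists e : nat -> R, e @ \oo --> (0 : R) /\
      forall k : nat, (1 <= k)%N ->
        1 - rll_capacity k (p k) <= (b_U c + e k) / 2 ^+ k.+1).
Proof.
have p0 k : (1 <= k)%N -> 0 <= p k by move=> /hp /andP[].
have c0 : 0 <= c.
  apply: (cvgr_to_ge hc); exists 1%N => // k /= k1.
  by rewrite invrK mulr_ge0 ?p0 // exprn_ge0.
pose d k := 2 ^+ k.+1 * rate_defect (slot_ratio R k) (p k).
have dl : d @ \oo --> b_U c by exact: cvg_scaled_defect.
have cap k : (1 <= k)%N -> 1 - rll_capacity k (p k) <= d k / 2 ^+ k.+1.
  move=> k1; rewrite /d mulrC mulKf ?expf_neq0 ?pnatr_eq0 //.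
  apply: capacity_defect_le => //; case/andP: (hp k k1) => -> /= /le_trans-> //.
  by rewrite invf_le1 ?exprn_gt0 // exprn_ege1 // ler1n.
(* The relative error divides by [b_U c], which is 0 at [c = 1]; the additive error also covers that
   case. *)
split=> [c1|].
- have b0 : 0 < b_U c by rewrite b_U_gt0 // c0.
  exists (fun k => d k / b_U c - 1); split.
    rewrite -[X in _ --> X](subrr 1) -{2}(mulfV (lt0r_neq0 b0)).
    by apply: cvgB; [apply: cvgM => //; exact: cvg_cst|exact: cvg_cst].
  move=> k k1; apply: le_trans (cap k k1) _.
  by rewrite [1 + _]addrC subrK [leRHS]mulrAC [b_U c * _]mulrC divfK // lt0r_neq0.
- exists (fun k => d k - b_U c); split.
    by rewrite -[X in _ --> X](subrr (b_U c)); apply: cvgB => //; exact: cvg_cst.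
  by move=> k k1; rewrite [b_U c + _]addrC subrK cap.
Qed.
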